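(* Let $\Bbbk$ be a field of characteristic zero, let $A_1,\dots,A_n$ be finite subsets of $\Bbbk$, let $\nu_i:A_i\to\mathbb{N}$ ($i=1,\dots,n$) be functions with positive integer values, put $\mathbf{A}=A_1\times\cdots\times A_n$, and let $H_i(x_i)=\prod_{a\in A_i}(x_i-a)^{\nu_i(a)}\in\Bbbk[x_i]$. Let $T_{(\mathbf{A},\nu,\Bbbk)}:\Bbbk[x_1,\dots,x_n]\to V(\mathbf{A},\nu)$ be the linear operator $$T_{(\mathbf{A},\nu,\Bbbk)}(f)=\sum_{\mathbf{a}\in\mathbf{A}}\ \sum_{\mathbf{k}\in[\mathbf{0},\nu(\mathbf{a})-\mathbf{1}]}\left(\partial_{\mathbf{a}}^{\mathbf{k}}f\right)H_{\mathbf{a}}^{\mathbf{k}}.$$ Then $$(H_1,\dots,H_n)=\ker T_{(\mathbf{A},\nu,\Bbbk)},$$ where $(H_1,\dots,H_n)$ is the ideal of $\Bbbk[x_1,\dots,x_n]$ generated by $H_1,\dots,H_n$.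
   Context: For $\mathbf{a}=(a_1,\dots,a_n)\in\mathbf{A}$, $\nu(\mathbf{a}):=(\nu_1(a_1),\dots,\nu_n(a_n))$, and $[\mathbf{0},\nu(\mathbf{a})-\mathbf{1}]$ is the set of $\mathbf{k}=(k_1,\dots,k_n)$ with integers $0\le k_i\le\nu_i(a_i)-1$. $\partial_{\mathbf{a}}^{\mathbf{k}}f$ is the value at $\mathbf{x}=\mathbf{a}$ of the formal partial derivative $\frac{\partial^{k_1+\cdots+k_n}f}{\partial x_1^{k_1}\cdots\partial x_n^{k_n}}$. $V(\mathbf{A},\nu)$ is the space of $f\in\Bbbk[x_1,\dots,x_n]$ with $\deg_i f<\sum_{a\in A_i}\nu_i(a)$ for all $i$ ($\deg_i$ is the degree in $x_i$; zero polynomial included). For $a_j\in A_j$ and $0\le k_j\le\nu_j(a_j)-1$ let $H_{a_j}(x_j):=\prod_{c\in A_j,\,c\ne a_j}\left(\frac{x_j-c}{a_j-c}\right)^{\nu_j(c)}$, $$H_{a_j}^{k_j}(x_j):=H_{a_j}(x_j)\,\frac{(x_j-a_j)^{k_j}}{k_j!}\sum_{t=0}^{\nu_j(a_j)-k_j-1}\frac{(x_j-a_j)^t}{t!}\,\left.\frac{d^t}{dx_j^t}\left(\frac{1}{H_{a_j}(x_j)}\right)\right|_{x_j=a_j}\in\Bbbk[x_j]$$ (formal derivative of a rational function, evaluated at $a_j$), and $H_{\mathbf{a}}^{\mathbf{k}}(x_1,\dots,x_n):=\prod_{j=1}^nH_{a_j}^{k_j}(x_j)$. *)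

(* Defs.v *)
From HB Require Import structures.
From mathcomp Require Import all_boot all_order all_algebra.
From mathcomp Require Import ring zify.
From mathcomp Require Export generic_quotient fraction finmap.
From mathcomp Require Export mpoly.

Set Implicit Arguments.
Unset Strict Implicit.
Unset Printing Implicit Defensive.

Import GRing.Theory.
Local Open Scope ring_scope.
Local Open Scope quotient_scope.

(* Formal derivative in k(x), by the quotient rule on the representative that
   [repr] picks; frac_derivE shows that the choice does not matter. *)
Definition frac_deriv (K : fieldType) (x : {fraction {poly K}}) :
    {fraction {poly K}} :=
  let p := \n_(repr x) in let q := \d_(repr x) in
  tofrac (p^`() * q - p * q^`()) / tofrac (q ^+ 2).

(* Value at [a] of a rational function, read off in lowest terms; by frac_evalE
   any fraction whose denominator does not vanish at [a] gives the same value.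
   Meaningless when [a] is a pole. *)
Definition frac_eval (K : fieldType) (x : {fraction {poly K}}) (a : K) : K :=
  let p := \n_(repr x) in let q := \d_(repr x) in
  let d := gcdp p q in (p %/ d).[a] / (q %/ d).[a].

Lemma repr_fracE (K : fieldType) (x : {fraction {poly K}}) :
  x = tofrac \n_(repr x) / tofrac \d_(repr x).
Proof.
have dn0 := denom_ratioP (repr x).
have dF : tofrac \d_(repr x) != 0 by rewrite tofrac_eq0.
apply: (mulIf dF); rewrite divfK //.
rewrite -{1}[x]reprK; unlock FracField.tofrac.
rewrite -[LHS]FracField.pi_mul; apply/eqmodP; rewrite /= FracField.equivfE.
by rewrite /FracField.mulf !numden_Ratio ?mulf_neq0 ?oner_eq0 // !mulr1 mulrC.
Qed.

Lemma tofrac_divE (K : fieldType) (p q r s : {poly K}) : q != 0 -> s != 0 ->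
  p * s = r * q -> tofrac p / tofrac q = tofrac r / tofrac s.
Proof.
move=> q0 s0 E; have := congr1 (@FracField.tofrac _) E; rewrite !tofracM => {}E.
have qF : tofrac q != 0 by rewrite tofrac_eq0.
have sF : tofrac s != 0 by rewrite tofrac_eq0.
by apply/eqP; rewrite (eqr_div _ _ qF sF); apply/eqP.
Qed.

Lemma repr_frac_cross (K : fieldType) (p q : {poly K}) : q != 0 ->
  let x := repr (tofrac p / tofrac q) in \n_x * q = p * \d_x.
Proof.
move=> q0 x; have dn0 := denom_ratioP x.
apply/eqP; rewrite -tofrac_eq !tofracM -eqr_div ?tofrac_eq0 //.
by rewrite -repr_fracE.
Qed.

Lemma frac_derivE (K : fieldType) (p q : {poly K}) : q != 0 ->
  frac_deriv (tofrac p / tofrac q)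
  = tofrac (p^`() * q - p * q^`()) / tofrac (q ^+ 2).
Proof.
move=> q0; have := repr_frac_cross p q0; rewrite /frac_deriv.
set x := repr _ => /= E; have dn0 := denom_ratioP x.
move: dn0 E; move: (\n_x) (\d_x) => n d d0 E.
apply: tofrac_divE; rewrite ?expf_neq0 //.
have E' : n^`() * q = p^`() * d + p * d^`() - n * q^`().
  by rewrite -derivM -E derivM addrK.
transitivity (n^`() * q * (q * d) - n * q * (q * d^`())); first by ring.
rewrite E' E; transitivity (p^`() * d * (q * d) - n * q * (q^`() * d)); first by ring.
by rewrite E; ring.
Qed.

Lemma frac_evalE (K : fieldType) (p q : {poly K}) (a : K) : q.[a] != 0 ->
  frac_eval (tofrac p / tofrac q) a = p.[a] / q.[a].
Proof.
move=> qa; have q0 : q != 0 by apply: contraNneq qa => ->; rewrite horner0.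
have := repr_frac_cross p q0; rewrite /frac_eval.
set x := repr _ => /= E; have dn0 := denom_ratioP x.
move: dn0 E; move: (\n_x) (\d_x) => n d d0 E.
set g := gcdp n d; have g0 : g != 0 by rewrite gcdp_eq0 negb_and d0 orbT.
have En : n = n %/ g * g by rewrite divpK // dvdp_gcdl.
have Ed : d = d %/ g * g by rewrite divpK // dvdp_gcdr.
have cop : coprimep (n %/ g) (d %/ g).
  by apply: coprimep_div_gcd; rewrite d0 orbT.
have {}E : n %/ g * q = p * (d %/ g).
  by apply: (mulIf g0); rewrite mulrAC -En E -mulrA -Ed.
have dq : (d %/ g) %| q.
  rewrite -(@Gauss_dvdpr _ _ (n %/ g)); last by rewrite coprimep_sym.
  by rewrite E dvdp_mull.
have da : (d %/ g).[a] != 0.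
  by apply: contraNneq qa => da; have /dvdpP[r ->] := dq; rewrite hornerM da mulr0.
by apply/eqP; rewrite (eqr_div _ _ da qa) -!hornerM E.
Qed.

Definition node_poly (K : fieldType) (A : {fset K}) (nu : A -> nat) (a : A) :
    {poly K} :=
  \prod_(c : A | c != a)
     ((val a - val c)^-1 *: ('X - (val c)%:P)) ^+ nu c.

(* The Hermite basis polynomial H_a^k: the sum is the Taylor polynomial of
   1 / H at [a] with H = node_poly nu a, so that H_a^k has k-th derivative 1 at
   [a], and its other derivatives of order < nu c at the nodes [c] vanish. *)
Definition hermite_poly (K : fieldType) (A : {fset K}) (nu : A -> nat)
    (a : A) (k : 'I_(nu a)) : {poly K} :=
  let H := node_poly nu a in
  H * ((k`!%:R)^-1 *: ('X - (val a)%:P) ^+ k)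
  * \sum_(0 <= t < nu a - k)
      ((t`!%:R)^-1 * frac_eval (iter t (@frac_deriv K) (tofrac H)^-1) (val a))
        *: ('X - (val a)%:P) ^+ t.

Definition vanish_poly (K : fieldType) (A : {fset K}) (nu : A -> nat) :
    {poly K} :=
  \prod_(a : A) ('X - (val a)%:P) ^+ nu a.

Definition poly_in (K : fieldType) (n : nat) (i : 'I_n) (p : {poly K}) :
    {mpoly K[n]} :=
  horner_alg ('X_i : {mpoly K[n]}) p.

Definition mexp (n : nat) (i : 'I_n) (m : 'X_{1..n}) : nat := m i.

Lemma mexp0 (n : nat) (i : 'I_n) : mexp i 0%MM = 0%N.
Proof. exact: mnm0E. Qed.

Lemma mexpD (n : nat) (i : 'I_n) :
  {morph mexp i : m1 m2 / (m1 + m2)%MM >-> (m1 + m2)%N}.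
Proof. by move=> m1 m2; exact: mnmDE. Qed.

HB.instance Definition _ (n : nat) (i : 'I_n) :=
  isMeasure.Build n (mexp i) (mexp0 i) (mexpD i).

(* deg_i f + 1, and 0 for f = 0 (the convention of [size] and [msize]), so that
   deg_i f < s is msize_in i f <= s, also for s = 0 *)
Definition msize_in (K : fieldType) (n : nat) (i : 'I_n) (f : {mpoly K[n]}) :
    nat :=
  mmeasure (mexp i) f.

Definition hermite_pred (K : fieldType) (n : nat) (A : 'I_n -> {fset K})
    (nu : forall i : 'I_n, A i -> nat) : {pred {mpoly K[n]}} :=
  fun f => [forall i, (msize_in i f <= \sum_(a : A i) nu i a)%N].

Lemma hermite_submod_closed (K : fieldType) (n : nat) (A : 'I_n -> {fset K})
    (nu : forall i : 'I_n, A i -> nat) : submod_closed (hermite_pred nu).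
Proof.
split=> [|c p q /forallP Hp /forallP Hq]; apply/forallP => i.
  by rewrite /msize_in mmeasure0.
apply: leq_trans (mmeasureD_le _ _ _) _; rewrite geq_max.
by rewrite (leq_trans (mmeasureZ_le _ _ _) (Hp i)) Hq.
Qed.

HB.instance Definition _ (K : fieldType) (n : nat) (A : 'I_n -> {fset K})
    (nu : forall i : 'I_n, A i -> nat) :=
  GRing.isSubmodClosed.Build K {mpoly K[n]} (hermite_pred nu)
    (hermite_submod_closed nu).

Record hermite_space (K : fieldType) (n : nat) (A : 'I_n -> {fset K})
    (nu : forall i : 'I_n, A i -> nat) : predArgType :=
  HermiteSpace { hermite_val :> {mpoly K[n]};
                 _ : hermite_val \in hermite_pred nu }.

HB.instance Definition _ (K : fieldType) (n : nat) (A : 'I_n -> {fset K})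
    (nu : forall i : 'I_n, A i -> nat) :=
  [isSub for @hermite_val K n A nu].
HB.instance Definition _ (K : fieldType) (n : nat) (A : 'I_n -> {fset K})
    (nu : forall i : 'I_n, A i -> nat) :=
  [Choice of hermite_space nu by <:].
HB.instance Definition _ (K : fieldType) (n : nat) (A : 'I_n -> {fset K})
    (nu : forall i : 'I_n, A i -> nat) :=
  [SubChoice_isSubLmodule of hermite_space nu by <:].

Notation grid A := {dffun forall i, A i}.
Notation box nu a := {dffun forall i, 'I_(nu i (a i))}.

Definition hermite_mpoly (K : fieldType) (n : nat) (A : 'I_n -> {fset K})
    (nu : forall i : 'I_n, A i -> nat) (a : grid A) (k : box nu a) :
    {mpoly K[n]} :=
  \prod_(j < n) poly_in j (hermite_poly (k j)).

Definition dderiv (K : fieldType) (n : nat) (A : 'I_n -> {fset K})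
    (nu : forall i : 'I_n, A i -> nat) (a : grid A) (k : box nu a)
    (f : {mpoly K[n]}) : K :=
  (f^`M[ [multinom (k i : nat) | i < n] ]).@[fun i => val (a i)].

Definition hermite_sum (K : fieldType) (n : nat) (A : 'I_n -> {fset K})
    (nu : forall i : 'I_n, A i -> nat) (f : {mpoly K[n]}) : {mpoly K[n]} :=
  \sum_(a : grid A) \sum_(k : box nu a) dderiv k f *: hermite_mpoly k.

Lemma size_node_poly (K : fieldType) (A : {fset K}) (nu : A -> nat) (a : A) :
  (size (node_poly nu a) <= (\sum_(c : A | c != a) nu c).+1)%N.
Proof.
rewrite /node_poly; elim/big_rec2: _ => [|c s p _ IH]; first by rewrite size_poly1.
apply: leq_trans (size_polyMleq _ _) _.
set l := _ *: _; have ls : (size l <= 2)%N.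
  by apply: leq_trans (size_scale_leq _ _) _; rewrite size_XsubC.
have : (size (l ^+ nu c) <= (nu c).+1)%N.
  apply: leq_trans (size_poly_exp_leq _ _) _; rewrite ltnS.
  rewrite -[leqRHS]mul1n leq_mul2r; apply/orP; right.
  by case: (size l) ls.
move=> H; have := leq_add H IH; move: (size _ + size _)%N => N.
by rewrite addSn addnS; case: N.
Qed.

Lemma size_hermite_poly (K : fieldType) (A : {fset K}) (nu : A -> nat) (a : A)
    (k : 'I_(nu a)) : (size (hermite_poly k) <= \sum_(c : A) nu c)%N.
Proof.
rewrite /hermite_poly (bigD1 a) //=.
set S := (\sum_(c | _) _)%N; set H := node_poly nu a.
have sX m : (size (('X - (val a)%:P : {poly K}) ^+ m) <= m.+1)%N.
  by rewrite size_exp_XsubC.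
have s1 (c : nat -> K) : (size (\sum_(0 <= t < nu a - k)
      c t *: ('X - (val a)%:P) ^+ t)%R <= nu a - k)%N.
  rewrite big_mkord; apply: leq_trans (size_sum _ _ _) _.
  apply/bigmax_leqP => t _; apply: leq_trans (size_scale_leq _ _) _.
  exact: leq_trans (sX t) (ltn_ord t).
have s2 : (size ((k`!%:R)^-1 *: ('X - (val a)%:P : {poly K}) ^+ k)%R <= k.+1)%N.
  exact: leq_trans (size_scale_leq _ _) (sX k).
have s3 : (size H <= S.+1)%N by exact: size_node_poly.
have s4 := size_polyMleq H ((k`!%:R)^-1 *: ('X - (val a)%:P) ^+ k).
apply: leq_trans (size_polyMleq _ _) _.
set T := (X in (_ + size X)%N); have : (size T <= nu a - k)%N.
  exact: (s1 (fun t => (t`!%:R)^-1 *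
    frac_eval (iter t (@frac_deriv K) (tofrac H)^-1) (val a))).
have L w h m x i N M : (x <= N - i -> m <= i.+1 -> h <= M.+1 ->
    w <= (h + m).-1 -> i < N -> (w + x).-1 <= N + M)%N by lia.
by move=> sT; exact: (L _ _ _ _ _ _ _ sT s2 s3 s4 (ltn_ord k)).
Qed.

Lemma msize_inM (K : fieldType) (n : nat) (i : 'I_n) (p q : {mpoly K[n]})
    (d e : nat) : (msize_in i p <= d.+1)%N -> (msize_in i q <= e.+1)%N ->
  (msize_in i (p * q) <= (d + e).+1)%N.
Proof.
move=> Hp Hq; rewrite /msize_in mmeasureE; apply/bigmax_leqP_seq => m.
move/msuppM_le/allpairsP => [[m1 m2] /= [m1p m2q ->]] _.
rewrite ltnS /mexp mnmDE; apply: leq_add; rewrite -ltnS.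
  exact: leq_trans (mmeasure_mnm_lt (mexp i) m1p) Hp.
exact: leq_trans (mmeasure_mnm_lt (mexp i) m2q) Hq.
Qed.

Lemma msize_in_poly_in (K : fieldType) (n : nat) (i j : 'I_n) (p : {poly K})
    (d : nat) : (size p <= d.+1)%N ->
  (msize_in i (poly_in j p) <= (if j == i then d else 0).+1)%N.
Proof.
move=> sp; rewrite /poly_in -[p]coefK poly_def linear_sum /=.
rewrite /msize_in; apply: leq_trans (mmeasure_sum _ _ _ _) _.
apply/bigmax_leqP => t _.
rewrite linearZ /= rmorphXn /= horner_algX; set x := 'X_j ^+ t.
have -> : (p`_t)%:A * x = p`_t *: x by rewrite -scalerAl mul1r.
apply: leq_trans (mmeasureZ_le _ _ _) _.
rewrite /x mpolyXn mmeasureX ltnS /= /mexp mulmnE mnm1E.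
case: eqP => _ //; rewrite mul1n.
by rewrite -ltnS; apply: leq_trans sp.
Qed.

Lemma hermite_mpoly_in (K : fieldType) (n : nat) (A : 'I_n -> {fset K})
    (nu : forall i : 'I_n, A i -> nat) (a : grid A) (k : box nu a) :
  hermite_mpoly k \in hermite_pred nu.
Proof.
apply/forallP => i; set s := (\sum_(a : A i) nu i a)%N.
have s0 : (0 < s)%N.
  by rewrite /s (bigD1 (a i)) //= ltn_addr //; case: (k i) => ? /=; case: (nu _ _).
suff H (r : seq 'I_n) : (msize_in i
    (\prod_(j <- r) poly_in j (hermite_poly (k j)))%R <=
    (\sum_(j <- r) (if j == i then s.-1 else 0)).+1)%N.
  by apply: leq_trans (H _) _; rewrite -big_mkcond big_pred1_eq prednK.
elim: r => [|j r IH]; first by rewrite !big_nil /msize_in mmeasure1.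
rewrite !big_cons; apply: msize_inM IH.
have [->|ji] := eqVneq j i.
  have := @msize_in_poly_in K n i i (hermite_poly (k i)) s.-1.
  by rewrite eqxx prednK //; apply; exact: size_hermite_poly.
have := @msize_in_poly_in K n i j _ _ (leqSpred (size (hermite_poly (k j)))).
by rewrite (negPf ji).
Qed.

Lemma hermite_sum_in (K : fieldType) (n : nat) (A : 'I_n -> {fset K})
    (nu : forall i : 'I_n, A i -> nat) (f : {mpoly K[n]}) :
  hermite_sum nu f \in hermite_pred nu.
Proof.
by apply: rpred_sum => a _; apply: rpred_sum => k _; apply/rpredZ/hermite_mpoly_in.
Qed.

Definition hermite_op (K : fieldType) (n : nat) (A : 'I_n -> {fset K})
    (nu : forall i : 'I_n, A i -> nat) (f : {mpoly K[n]}) : hermite_space nu :=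
  HermiteSpace (hermite_sum_in nu f).

Lemma hermite_op_is_linear (K : fieldType) (n : nat) (A : 'I_n -> {fset K})
    (nu : forall i : 'I_n, A i -> nat) : linear (hermite_op nu).
Proof.
move=> c f g; apply: val_inj; rewrite /= /hermite_sum.
rewrite scaler_sumr -big_split; apply: eq_bigr => a _ /=.
rewrite scaler_sumr -big_split; apply: eq_bigr => k _ /=.
by rewrite /dderiv linearP mevalD mevalZ scalerDl scalerA.
Qed.

HB.instance Definition _ (K : fieldType) (n : nat) (A : 'I_n -> {fset K})
    (nu : forall i : 'I_n, A i -> nat) :=
  GRing.isLinear.Build K {mpoly K[n]} (hermite_space nu) _ (hermite_op nu)
    (hermite_op_is_linear nu).

Definition in_ideal (R : comNzRingType) (I : finType) (h : I -> R) (f : R) :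
    Prop :=
  exists g : I -> R, f = \sum_(i : I) g i * h i.

(* Main.v *)
(* On monomials, hence on products of univariate polynomials, T factors as the
   product of the univariate Hermite interpolation operators T_j. Modulo
   (x_j - a)^nu_j(a) only the basis polynomials attached to a survive in T_j p,
   and they reduce to (x_j - a)^k / k!, so T_j p is congruent to the Taylor
   polynomial of p, that is to p; by coprimality T_j p = p modulo H_j. Hence
   f - T f always lies in the ideal, which gives one inclusion; the other one
   holds because T_j (q H_j) = 0. *)

Require Import Defs.
From HB Require Import structures.
From mathcomp Require Import all_boot all_order all_algebra.
From mathcomp Require Import finmap mpoly.
From mathcomp Require Import ring.

Set Implicit Arguments.
Unset Strict Implicit.
Unset Printing Implicit Defensive.

Import GRing.Theory.
Local Open Scope ring_scope.

(** * Powers of X - a, derivatives and Taylor's formula for polynomials *)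

Lemma dvdp_XsubC_deriv (K : fieldType) (a : K) (m : nat) (p : {poly K}) :
  ('X - a%:P) ^+ m.+1 %| p -> ('X - a%:P) ^+ m %| p^`().
Proof.
move=> /dvdpP[q ->]; rewrite derivM deriv_exp derivXsubC mul1r /=.
apply: dvdp_add; apply: dvdp_mull; first by rewrite exprS dvdp_mull.
by rewrite -mulr_natl dvdp_mull.
Qed.

Lemma dvdp_sum (K : fieldType) (I : Type) (r : seq I) (P : pred I)
    (F : I -> {poly K}) (d : {poly K}) :
  (forall i, P i -> d %| F i) -> d %| \sum_(i <- r | P i) F i.
Proof.
move=> dvF; apply: (big_ind (fun p => d %| p)) => [|u v|//].
  exact: dvdp0.
exact: dvdp_add.
Qed.

Lemma derivn_horner_eq0 (K : fieldType) (a : K) (m k : nat) (p : {poly K}) :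
  (k < m)%N -> ('X - a%:P) ^+ m %| p -> p^`(k).[a] = 0.
Proof.
elim: k m p => [|k IH] [|m] p //= ltkm dvp.
  apply/eqP; rewrite -/(root p a) -dvdp_XsubCl; apply: dvdp_trans dvp.
  by rewrite exprS dvdp_mulr.
by rewrite -derivnS derivSn (IH m) // dvdp_XsubC_deriv.
Qed.

Lemma taylor_dvdp (K : fieldType) (charK : [pchar K] =i pred0) (a : K)
    (N : nat) (p : {poly K}) :
  ('X - a%:P) ^+ N %|
    p - \sum_(t < N) ((t`!%:R)^-1 * p^`(t).[a]) *: ('X - a%:P) ^+ t.
Proof.
(* Padding to [maxn (size p) N] terms lets the first N terms be split off even when N exceeds the
   size of p. The expansion is Taylor's formula over K[X] at the point a + (X - a); characteristic
   zero allows the division by t!. *)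
have taylor : p = \sum_(t < maxn (size p) N)
    ((t`!%:R)^-1 * p^`(t).[a]) *: ('X - a%:P) ^+ t.
  have eX : a%:P + ('X - a%:P) = 'X by rewrite addrC subrK.
  rewrite -[LHS]comp_polyXr /comp_poly -[X in _.[X]]eX.
  rewrite (@nderiv_taylor_wide _ (maxn (size p) N)) ?size_map_polyC
    ?leq_maxl //; last exact: mulrC.
  apply: eq_bigr => t _; rewrite nderivn_map horner_map /= mul_polyC.
  rewrite nderivn_def hornerMn -[p^`N(t).[a] *+ _]mulr_natl mulKf //.
  by rewrite (pcharf0P K).1 // -lt0n fact_gt0.
rewrite {1}taylor (big_ord_widen _ (fun t => ((t`!%:R)^-1 * p^`(t).[a]) *:
  ('X - a%:P) ^+ t) (leq_maxr (size p) N)).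
rewrite (bigID (fun t : 'I__ => (t < N)%N)) /= addrAC subrr add0r.
apply: dvdp_sum => t; rewrite -leqNgt => leNt.
by rewrite -mul_polyC dvdp_mull // dvdp_exp2l.
Qed.

(** * Taylor expansion of 1 / H *)

(** The quotient rule turns the error r = p - G^(t) q into r' q - r q', so each differentiation
    costs one power of X - a. The denominators stay nonzero at a, as [frac_evalE] requires. *)
Lemma iter_frac_deriv_congr (K : fieldType) (a : K) (N : nat)
    (H G : {poly K}) : H.[a] != 0 -> ('X - a%:P) ^+ N %| 1 - G * H ->
  forall t, (t <= N)%N -> exists p q : {poly K},
    [/\ q.[a] != 0,
        iter t (@frac_deriv K) (tofrac H)^-1 = tofrac p / tofrac q
      & ('X - a%:P) ^+ (N - t) %| p - G^`(t) * q].
Proof.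
move=> Ha dvG; elim=> [|t IH] letN.
  by exists 1, H; split; rewrite ?subn0 // tofrac1 div1r.
have [p [q [qa /= -> /dvdpP[w Ew]]]] := IH (ltnW letN).
have q0 : q != 0 by apply: contraNneq qa => ->; rewrite horner0.
exists (p^`() * q - p * q^`()), (q ^+ 2); split.
- by rewrite horner_exp expf_neq0.
- exact: frac_derivE.
set r := p - G^`(t) * q in Ew.
have Er : p^`() * q - p * q^`() - G^`(t.+1) * q ^+ 2 = r^`() * q - r * q^`().
  by rewrite /r derivB derivM derivnS; ring.
have dvr : ('X - a%:P) ^+ (N - t.+1).+1 %| r.
  by rewrite -subSn // subSS Ew dvdp_mull.
rewrite Er dvdp_sub ?dvdp_mulr ?dvdp_XsubC_deriv //.
by apply: dvdp_trans dvr; rewrite exprS dvdp_mull.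
Qed.

(* A polynomial inverse G of H modulo (X - a)^N has the same derivatives at a
   as 1 / H up to order N - 1, which reduces the claim to Taylor's formula for
   polynomials. *)
Lemma frac_inv_taylor_dvdp (K : fieldType) (charK : [pchar K] =i pred0) (a : K)
    (N : nat) (H : {poly K}) : H.[a] != 0 ->
  ('X - a%:P) ^+ N %| 1 - H * \sum_(0 <= t < N)
    ((t`!%:R)^-1 * frac_eval (iter t (@frac_deriv K) (tofrac H)^-1) a)
      *: ('X - a%:P) ^+ t.
Proof.
move=> Ha.
have cop : coprimep (('X - a%:P) ^+ N) H.
  by rewrite coprimep_expl // coprimep_sym coprimep_XsubC.
have [G dvG] : exists G, ('X - a%:P) ^+ N %| 1 - G * H.
  have /Bezout_eq1_coprimepP[[u v] /= <-] := cop.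
  by exists v; rewrite addrK dvdp_mull.
rewrite big_mkord.
under eq_bigr => t _.
  have [p [q [qa -> dvp]]] := iter_frac_deriv_congr Ha dvG (ltnW (ltn_ord t)).
  rewrite frac_evalE //.
  (* As t < N, at least one factor X - a divides p - G^(t) q, so this difference vanishes at a. *)
  have -> : p.[a] / q.[a] = G^`(t).[a].
    apply: (canLR (mulfK qa)); apply/eqP; rewrite -subr_eq0 -hornerM -hornerN.
    rewrite -hornerD -/(root _ a) -dvdp_XsubCl; apply: dvdp_trans dvp.
    by rewrite -(subnSK (ltn_ord t)) exprS dvdp_mulr.
  over.
have := taylor_dvdp charK a N G; set S := \sum_(t < N) _ => dvS.
have -> : 1 - H * S = 1 - G * H + H * (G - S) by ring.
by rewrite dvdp_add // dvdp_mull.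
Qed.

(** * Hermite interpolation in one variable *)

Lemma node_poly_self (K : fieldType) (A : {fset K}) (nu : A -> nat) (a : A) :
  (node_poly nu a).[val a] = 1.
Proof.
rewrite /node_poly horner_prod big1 // => c ca.
by rewrite horner_exp !hornerE mulVf ?expr1n // subr_eq0 eq_sym.
Qed.

Lemma dvdp_node_poly (K : fieldType) (A : {fset K}) (nu : A -> nat) (a c : A) :
  c != a -> ('X - (val c)%:P) ^+ nu c %| node_poly nu a.
Proof.
move=> ca; rewrite /node_poly (bigD1 c) //= exprZn -scalerAl.
by rewrite -mul_polyC dvdp_mull // dvdp_mulr.
Qed.

(** With S the truncated expansion of 1 / H, the difference 1 - H S is divisible by (X - a)^(nu a -
    k); the factor (X - a)^k supplies the missing powers. *)
Lemma dvdp_hermite_poly_self (K : fieldType) (charK : [pchar K] =i pred0)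
    (A : {fset K}) (nu : A -> nat) (a : A) (k : 'I_(nu a)) :
  ('X - (val a)%:P) ^+ nu a %|
    (k`!%:R)^-1 *: ('X - (val a)%:P) ^+ k - hermite_poly k.
Proof.
have Ha : (node_poly nu a).[val a] != 0 by rewrite node_poly_self oner_neq0.
have := frac_inv_taylor_dvdp charK (nu a - k) Ha; rewrite /hermite_poly.
set H := node_poly nu a; set S := \sum_(_ <= _ < _) _ => dvS.
have -> : (k`!%:R)^-1 *: ('X - (val a)%:P) ^+ k
    - H * ((k`!%:R)^-1 *: ('X - (val a)%:P) ^+ k) * S
  = (k`!%:R)^-1 *: (('X - (val a)%:P) ^+ k * (1 - H * S)).
  by rewrite -!mul_polyC; ring.
rewrite -mul_polyC dvdp_mull //.
by rewrite -{1}(subnKC (ltnW (ltn_ord k))) exprD dvdp_mul.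
Qed.

(** The powers attached to distinct nodes are coprime. *)
Lemma dvdp_vanish_poly (K : fieldType) (A : {fset K}) (nu : A -> nat)
    (p : {poly K}) :
  (forall a : A, ('X - (val a)%:P) ^+ nu a %| p) -> vanish_poly nu %| p.
Proof.
move=> dvp; rewrite /vanish_poly.
elim: (index_enum _) (index_enum_uniq A) => [|a s IH] /=.
  by rewrite big_nil dvd1p.
case/andP=> as_ us; rewrite big_cons Gauss_dvdp ?dvp ?IH //.
rewrite big_seq; apply: (big_ind (coprimep _)) => [|q r|c cs].
- exact: coprimep1.
- by move=> cq cr; rewrite coprimepMr cq.
rewrite coprimep_expl // coprimep_expr // coprimep_XsubC root_XsubC.
by apply: contraNneq as_ => /val_inj <-.
Qed.

(** The one-variable operator T_j, with values in the whole of K[X]. *)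
Definition hermite_interp (K : fieldType) (A : {fset K}) (nu : A -> nat)
    (p : {poly K}) : {poly K} :=
  \sum_(a : A) \sum_(k < nu a) p^`(k).[val a] *: hermite_poly k.

Lemma hermite_interp_is_linear (K : fieldType) (A : {fset K}) (nu : A -> nat) :
  linear (hermite_interp nu).
Proof.
move=> c p q; rewrite /hermite_interp scaler_sumr -big_split.
apply: eq_bigr => a _; rewrite scaler_sumr -big_split; apply: eq_bigr => k _ /=.
by rewrite linearP hornerD hornerZ scalerDl scalerA.
Qed.

HB.instance Definition _ (K : fieldType) (A : {fset K}) (nu : A -> nat) :=
  GRing.isLinear.Build K {poly K} {poly K} _ (hermite_interp nu)
    (hermite_interp_is_linear nu).

Lemma hermite_interp_mul_vanish (K : fieldType) (A : {fset K}) (nu : A -> nat)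
    (q : {poly K}) : hermite_interp nu (q * vanish_poly nu) = 0.
Proof.
rewrite /hermite_interp big1 // => a _; rewrite big1 // => k _.
rewrite (derivn_horner_eq0 (ltn_ord k)) ?scale0r // dvdp_mull //.
by rewrite /vanish_poly (bigD1 a) //= dvdp_mulr.
Qed.

Lemma dvdp_sub_hermite_interp (K : fieldType) (charK : [pchar K] =i pred0)
    (A : {fset K}) (nu : A -> nat) (p : {poly K}) :
  vanish_poly nu %| p - hermite_interp nu p.
Proof.
apply: dvdp_vanish_poly => a; rewrite /hermite_interp (bigD1 a) //=.
rewrite opprD addrA dvdp_sub //; last first.
  (* For c different from a, the node polynomial at c already contains the full power of X - a. *)
  apply: dvdp_sum => c ca; apply: dvdp_sum => k _.
  rewrite /hermite_poly -mul_polyC dvdp_mull // -mulrA dvdp_mulr //.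
  by rewrite dvdp_node_poly // eq_sym.
have := taylor_dvdp charK (val a) (nu a) p; set S := \sum_(t < _) _ => dvS.
(* The terms attached to a are compared one by one with those of the Taylor polynomial S of p. *)
rewrite -[p](subrK S) -addrA dvdp_add // subrK /S -sumrB.
apply: dvdp_sum => k _.
rewrite [_^-1 * _]mulrC -scalerA -scalerBr -mul_polyC dvdp_mull //.
exact: dvdp_hermite_poly_self.
Qed.

(** * Factorization of T on monomials *)

(** Encoding a dependent choice as a function into tagged values reduces this to ordinary
    distributivity. *)
Lemma bigA_distr_dffun (R : comPzSemiRingType) (I : finType) (T : I -> finType)
    (F : forall i, T i -> R) :
  \sum_(t : {dffun forall i, T i}) \prod_i F i (t i)
  = \prod_i \sum_(x : T i) F i x.
Proof.
rewrite (reindex (@dffun_of_fprod I T)); last first.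
  exists (@fprod_of_dffun I T) => x _; first exact: dffun_of_fprodK.
  exact: fprod_of_dffunK.
transitivity (\sum_(t : fprod T) \prod_(i in I) [ffun x => F i x] (t i)).
  by apply: eq_bigr => t _; apply: eq_bigr => i _; rewrite !ffunE.
rewrite big_fprod.
(* [untag 0] gives 0 at values whose tag is not i; [tagged_with] keeps them out of the sum. *)
rewrite -(bigA_distr_big_dep (tagged_with T)
  (fun i => untag 0 [ffun x => F i x])).
apply: eq_bigr => i _.
rewrite -(big_tag (fun i : I => [ffun x => F i x] : T i -> R) i).
by apply: eq_bigr => x _; rewrite ffunE.
Qed.

Lemma dderivX (K : fieldType) (n : nat) (A : 'I_n -> {fset K})
    (nu : forall i : 'I_n, A i -> nat) (a : grid A) (k : box nu a)
    (m : 'X_{1..n}) :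
  dderiv k 'X_[m] = \prod_(i < n) ('X^(m i))^`(k i).[val (a i)].
Proof.
rewrite /dderiv mderivmX mevalZ mevalX natr_prod -big_split.
apply: eq_bigr => i _.
by rewrite /= mnmBE !mnmE derivnXn hornerMn hornerXn mulr_natl.
Qed.

Lemma hermite_sumX (K : fieldType) (n : nat) (A : 'I_n -> {fset K})
    (nu : forall i : 'I_n, A i -> nat) (m : 'X_{1..n}) :
  hermite_sum nu 'X_[m]
  = \prod_(i < n) poly_in i (hermite_interp (nu i) 'X^(m i)).
Proof.
transitivity (\prod_(i < n) \sum_(a : A i) \sum_(k < nu i a)
    poly_in i (('X^(m i))^`(k).[val a] *: hermite_poly k)).
  (* Distributivity is used twice: for the nodes a, then for the orders k, whose ranges depend on
     a. *)
  rewrite -bigA_distr_dffun; apply: eq_bigr => a _.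
  rewrite -bigA_distr_dffun; apply: eq_bigr => k _.
  rewrite dderivX /hermite_mpoly -scaler_prod.
  by apply: eq_bigr => i _; rewrite /poly_in linearZ /= mulr_algl.
apply: eq_bigr => i _; rewrite /poly_in /hermite_interp linear_sum.
by apply: eq_bigr => a _; rewrite linear_sum.
Qed.

Lemma poly_inXn (K : fieldType) (n : nat) (i : 'I_n) (t : nat) :
  poly_in i ('X^t : {poly K}) = 'X_i ^+ t.
Proof. by rewrite /poly_in rmorphXn /= horner_algX. Qed.

(** Inherited from [hermite_op], for use in the polynomial ring itself. *)
Lemma hermite_sum_is_linear (K : fieldType) (n : nat) (A : 'I_n -> {fset K})
    (nu : forall i : 'I_n, A i -> nat) : linear (hermite_sum nu).
Proof. by move=> c f g; have := congr1 val (linearP (hermite_op nu) c f g). Qed.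

HB.instance Definition _ (K : fieldType) (n : nat) (A : 'I_n -> {fset K})
    (nu : forall i : 'I_n, A i -> nat) :=
  GRing.isLinear.Build K {mpoly K[n]} {mpoly K[n]} _ (hermite_sum nu)
    (hermite_sum_is_linear nu).

(** * Vanishing of T on multiples of the generators *)

(** By linearity g may be taken to be a monomial. Multiplying it by a polynomial in x_i changes only
    the i-th factor of its image, which becomes T_i applied to x_i^(m i) H_i, hence 0. *)
Lemma hermite_sum_mul_vanish (K : fieldType) (n : nat) (A : 'I_n -> {fset K})
    (nu : forall i : 'I_n, A i -> nat) (i : 'I_n) (g : {mpoly K[n]}) :
  hermite_sum nu (g * poly_in i (vanish_poly (nu i))) = 0.
Proof.
rewrite [g]mpolyE mulr_suml linear_sum big1 // => m _.
rewrite -scalerAl linearZ /=; set H := vanish_poly (nu i).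
suff -> : hermite_sum nu ('X_[m] * poly_in i H) = 0 by rewrite scaler0.
have eH : poly_in i H = \sum_(t < size H) H`_t *: 'X_i ^+ t.
  rewrite -{1}[H]coefK poly_def /poly_in linear_sum; apply: eq_bigr => t _.
  by rewrite linearZ /= mulr_algl -/(poly_in i _) poly_inXn.
pose P := \prod_(j < n | j != i) poly_in j (hermite_interp (nu j) 'X^(m j)).
have step t : hermite_sum nu ('X_[m] * 'X_i ^+ t)
    = poly_in i (hermite_interp (nu i) ('X^(m i) * 'X^t)) * P.
  rewrite mpolyXn -mpolyXD hermite_sumX (bigD1 i) //=.
  rewrite mnmDE mulmnE mnm1E eqxx mul1n exprD; congr (_ * _).
  by apply: eq_bigr => j /negPf ji; rewrite mnmDE mulmnE mnm1E eq_sym ji addn0.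
rewrite eH mulr_sumr linear_sum.
under eq_bigr => t _ do rewrite -scalerAr linearZ /= step scalerAl.
rewrite -mulr_suml.
(* Linearity of T_i reassembles H from its coefficients. *)
suff -> : \sum_(t < size H) H`_t *:
      poly_in i (hermite_interp (nu i) ('X^(m i) * 'X^t))
    = poly_in i (hermite_interp (nu i) ('X^(m i) * H)).
  by rewrite hermite_interp_mul_vanish /poly_in linear0 mul0r.
rewrite -[in RHS](coefK H) poly_def mulr_sumr linear_sum /poly_in linear_sum.
by apply: eq_bigr => t _; rewrite -scalerAr !linearZ /= mulr_algl.
Qed.

(** * Congruences modulo the ideal and the two inclusions *)

Lemma in_ideal0 (R : comNzRingType) (I : finType) (h : I -> R) : in_ideal h 0.
Proof. by exists (fun=> 0); rewrite big1 // => i _; rewrite mul0r. Qed.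

Lemma in_idealD (R : comNzRingType) (I : finType) (h : I -> R) (f g : R) :
  in_ideal h f -> in_ideal h g -> in_ideal h (f + g).
Proof.
move=> [u ->] [v ->]; exists (fun i => u i + v i).
by rewrite -big_split; apply: eq_bigr => i _; rewrite mulrDl.
Qed.

Lemma in_idealM (R : comNzRingType) (I : finType) (h : I -> R) (f g : R) :
  in_ideal h g -> in_ideal h (f * g).
Proof.
move=> [u ->]; exists (fun i => f * u i).
by rewrite mulr_sumr; apply: eq_bigr => i _; rewrite mulrA.
Qed.

Lemma in_ideal_gen (R : comNzRingType) (I : finType) (h : I -> R) (i : I) :
  in_ideal h (h i).
Proof.
exists (fun j => (j == i)%:R); rewrite (bigD1 i) //= eqxx mul1r big1 ?addr0 //.
by move=> j /negPf ->; rewrite mul0r.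
Qed.

(** The factors are replaced one at a time. This lifts the congruences in single variables to
    monomials. *)
Lemma in_ideal_sub_prod (R : comNzRingType) (I J : finType) (h : I -> R)
    (F G : J -> R) : (forall j, in_ideal h (F j - G j)) ->
  in_ideal h (\prod_j F j - \prod_j G j).
Proof.
move=> FG; elim: (index_enum J) => [|j r IH].
  by rewrite !big_nil subrr; exact: in_ideal0.
rewrite !big_cons; set u := \prod_(i <- r) F i; set v := \prod_(i <- r) G i.
have -> : F j * u - G j * v = F j * (u - v) + v * (F j - G j) by ring.
by apply: in_idealD; apply: in_idealM.
Qed.

Lemma in_ideal_sub_hermite_sum (K : fieldType) (charK : [pchar K] =i pred0)
    (n : nat) (A : 'I_n -> {fset K}) (nu : forall i : 'I_n, A i -> nat)
    (f : {mpoly K[n]}) :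
  in_ideal (fun i : 'I_n => poly_in i (vanish_poly (nu i)))
    (f - hermite_sum nu f).
Proof.
elim/mpolyind: f => [|c m p _ _ IH].
  by rewrite linear0 subrr; exact: in_ideal0.
(* The difference f - T f is linear in f, so only a monomial remains to be treated. *)
rewrite linearP /= opprD addrACA -scalerBr; apply: in_idealD => //.
rewrite -mul_mpolyC; apply: in_idealM.
rewrite hermite_sumX mpolyXE_id; apply: in_ideal_sub_prod => i.
rewrite -poly_inXn /poly_in -rmorphB.
(* [poly_in i] is a ring morphism, so divisibility by H_i in one variable gives membership in the
   ideal. *)
have /dvdpP[q ->] := dvdp_sub_hermite_interp charK (nu i) 'X^(m i).
rewrite rmorphM; apply: in_idealM.
exact: (in_ideal_gen (fun i : 'I_n => poly_in i (vanish_poly (nu i)))).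
Qed.

Theorem theorem4p3 (K : fieldType) (charK : [pchar K] =i pred0)
    (n : nat) (A : 'I_n -> {fset K}) (nu : forall i : 'I_n, A i -> nat)
    (nu_gt0 : forall (i : 'I_n) (a : A i), (0 < nu i a)%N)
    (f : {mpoly K[n]}) :
  in_ideal (fun i : 'I_n => poly_in i (vanish_poly (nu i))) f
  <-> hermite_op nu f = 0.
Proof.
split=> [[g ->]|/(congr1 val) /= Tf0].
  rewrite linear_sum big1 // => i _.
  by apply: val_inj; exact: hermite_sum_mul_vanish.
(* As T f = 0, f equals f - T f. *)
by rewrite -[f]subr0 -Tf0; exact: in_ideal_sub_hermite_sum.
Qed.
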